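(* For every nonsingular matrix $A\in\mathbb{R}^{n\times n}$ and every $1\leq k\leq d(A)-1$, $$\Psi_{k,\mathbb{R},\mathbb{R}}(A)=\Psi_{k,\mathbb{C},\mathbb{R}}(A)\leq \Psi_{k,\mathbb{C},\mathbb{C}}(A)\leq \Psi_{k,\mathbb{R},\mathbb{C}}(A).$$ Both inequalities can be strict: there exist a nonsingular real square matrix $A$ and $1\le k\le d(A)-1$ with $\Psi_{k,\mathbb{C},\mathbb{R}}(A)<\Psi_{k,\mathbb{C},\mathbb{C}}(A)$, and there exist a nonsingular real square matrix $A$ and $1\le k\le d(A)-1$ with $\Psi_{k,\mathbb{C},\mathbb{C}}(A)<\Psi_{k,\mathbb{R},\mathbb{C}}(A)$.
   Context: $\|\cdot\|$ is the Euclidean norm and $d(A)$ is the degree of the minimal polynomial of $A$. For $\mathbb{K},\mathbb{F}\in\{\mathbb{R},\mathbb{C}\}$, $\pi_{k,\mathbb{K}}$ denotes the set of polynomials $p$ with coefficients in $\mathbb{K}$, of degree at most $k$, with $p(0)=1$, and $$\Psi_{k,\mathbb{K},\mathbb{F}}(A)=\max_{b\in\mathbb{F}^{n},\ \|b\|=1}\ \min_{p\in\pi_{k,\mathbb{K}}}\|p(A)b\|.$$ *)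

(* Defs.v *)
From HB Require Import structures.
From mathcomp Require Import all_boot all_order all_algebra.
From mathcomp Require Import complex.
From mathcomp Require Import boolp classical_sets reals.

Set Implicit Arguments.
Unset Strict Implicit.
Unset Printing Implicit Defensive.

Import Order.TTheory GRing.Theory Num.Theory.
Local Open Scope classical_set_scope.
Local Open Scope ring_scope.
Local Open Scope complex_scope.

(* Greatest and least elements: unlike sup and inf, the value must belong to
   the set; it is the arbitrary default 0 when there is no such element. *)
Definition set_max (R : realType) (S : set R) : R :=
  xget 0 [set m | S m /\ ubound S m].

Definition set_min (R : realType) (S : set R) : R :=
  xget 0 [set m | S m /\ lbound S m].

(* Everything lives over R[i]; the choice between the real and the complex
   field is a predicate on R[i] constraining coefficients or coordinates. *)
Definition realF (R : realType) : {pred R[i]} := Num.real.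
Definition cplxF (R : realType) : {pred R[i]} := predT.
Arguments realF : clear implicits.
Arguments cplxF : clear implicits.

Definition enorm (R : realType) (n : nat) (v : 'cV[R[i]]_n) : R :=
  Num.sqrt (\sum_(i < n) Normc.normc (v i 0) ^+ 2).

Definition cmx (R : realType) (n : nat) (A : 'M[R]_n) : 'M[R[i]]_n :=
  map_mx (real_complex R) A.

Definition residual_polys (R : realType) (k : nat) (K : {pred R[i]}) :
    set {poly R[i]} :=
  [set p | [/\ p \is a polyOver K, (size p <= k.+1)%N & p.[0] = 1]].

Definition unit_sphere (R : realType) (n : nat) (F : {pred R[i]}) :
    set 'cV[R[i]]_n :=
  [set b | b \is a mxOver F /\ enorm b = 1].
Arguments unit_sphere {R} n F.

(* K constrains the polynomial coefficients, F the vector coordinates. Both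
   extrema are attained (a distance to a finite-dimensional affine subspace;
   an upper semicontinuous function on a compact sphere), so the default of
   set_min and set_max plays no role. *)
Definition Psi (R : realType) (n : nat) (k : nat) (K F : {pred R[i]})
    (A : 'M[R]_n.+1) : R :=
  set_max [set set_min [set enorm (horner_mx (cmx A) p *m b)
                       | p in residual_polys k K]
          | b in unit_sphere n.+1 F].

(* Main.v *)
Require Import Defs.
From mathcomp Require Import all_boot all_order all_algebra.
From mathcomp Require Import complex.
From mathcomp Require Import boolp classical_sets reals.
From mathcomp Require Import finmap ring lra.
From mathcomp Require Import topology normedtype matrix_normedtype.
Import Order.TTheory GRing.Theory Num.Theory.
Local Open Scope ring_scope.

(** Both extrema are attained.  For fixed [b] the vectors [p(A)b] form a real
    affine space of finite dimension, so the inner minimum is reached at an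
    orthogonal projection ([minimal_residual]).  As a function of [b] that
    minimum is an infimum of continuous functions, hence upper semicontinuous,
    and it reaches its maximum on the compact sphere ([Psi_attained]).
    Enlarging the set of vectors then enlarges Psi, and enlarging the set of
    coefficients decreases it: these are the two inequalities.  For the
    equality, take [b] real: the optimal residual over real coefficients is a
    real vector, so it is orthogonal not only to the vectors [A^j b] but also
    to the vectors [i A^j b], and complex coefficients do not improve it
    ([set_min_real_vector]).

    Strictness is detected by stagnation.  The choice [p = 1] gives Psi <= 1,
    with equality exactly when some nonzero [b] is orthogonal to all [A^j b],
    1 <= j <= k: over complex coefficients this means [b* A^j b = 0], over real
    coefficients only that the real part vanishes ([Psi_ge1], [Psi_lt1]).  So
    it is enough to find real matrices for which one of these systems of
    quadratic equations has a nonzero solution and another one has none.  Both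
    matrices below have order 4, and k = 3.

    First inequality.  Let [A] have the 2 x 2 blocks [7 Z], [11 I], [-11 I],
    [21 X], with [Z = diag(1, -1)] and [X] the exchange matrix.  Then
    [diag(I, -I) A] is symmetric, so the symmetric parts of the powers of [A]
    are block diagonal and the equations for a real vector [(u, w)] only
    involve the matrices [U = u u^T] and [W = w w^T].  They say that
    [9 tr U = 40 tr W] and that the traceless part of [U] is a linear image of
    that of [W].  This image is too small for both matrices to have rank one
    ([vector_gap_no_real_solution]), whereas multiples of the identity solve
    the equations; these come from a complex vector whose halves are isotropic,
    and the phase between the halves makes the imaginary parts vanish as well
    ([vector_gap_solution_stagnates]).

    Second inequality.  Let [A] have the blocks [6e J], [S], [e T], [6e J],
    with [J] the rotation by a right angle, [S = diag(1, 4)] and [T] the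
    symmetric matrix with rows [(20, 6)] and [(6, 5)].  This is a Hamiltonian
    matrix: [Q A] is symmetric for the complex structure [Q(u, w) = (-w, u)].
    Consequently, for a real vector [x], the real parts for [b = x + i Q x]
    vanish automatically for odd powers, and only the equation [x^T A^2 x = 0]
    is left ([coef_gap_solution_stagnates]).  For small [e], on the other hand,
    [A] is close to a nilpotent matrix.  Put [a, b = z1 + 2 z2, z1 - 2 z2] and
    [c, d = z3 + 2 z4, z3 - 2 z4].  The equations for [A] and [A^3] say that
    [a* c] and [b* d] are of order [e |z|^2], and the Hermitian form of [A^2]
    is, to leading order, positive on all vectors for which these two products
    vanish: its off-diagonal terms join [a, b, c, d] in a 4-cycle, each pair of
    neighbours gives a positive definite form, and the cycle has the sign that
    lets the whole form be indefinite ([four_cycle], [coef_gap_stagnates]). *)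

Set Implicit Arguments.
Unset Strict Implicit.
Unset Printing Implicit Defensive.

Import numFieldNormedType.Exports.
Local Notation Re := complex.Re.
Local Notation Im := complex.Im.

(** * The real inner product on complex vectors *)

Section RealInnerProduct.
Variables (R : realType) (n : nat).
Implicit Types (u v w : 'cV[R[i]]_n) (c : R).

(** The real part of [u* v].  Working with this real form treats real and
    complex coefficients alike: a complex span is the real span of twice as
    many vectors. *)
Definition rdot u v : R :=
  \sum_(i < n) (Re (u i 0) * Re (v i 0) + Im (u i 0) * Im (v i 0)).

Lemma rdotC u v : rdot u v = rdot v u.
Proof. by apply: eq_bigr => i _; rewrite mulrC [Im _ * _]mulrC. Qed.

Lemma rdotDl u v w : rdot (u + v) w = rdot u w + rdot v w.
Proof.
rewrite -big_split; apply: eq_bigr => i _; rewrite !mxE.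
by case: (u i 0) => ? ?; case: (v i 0) => ? ? /=; ring.
Qed.

Lemma rdotZl c u w : rdot (c%:C%C *: u) w = c * rdot u w.
Proof.
rewrite mulr_sumr; apply: eq_bigr => i _; rewrite !mxE.
by case: (u i 0) => ? ? /=; ring.
Qed.

Lemma rdotDr w u v : rdot w (u + v) = rdot w u + rdot w v.
Proof. by rewrite rdotC rdotDl !(rdotC w). Qed.

Lemma rdotZr c w u : rdot w (c%:C%C *: u) = c * rdot w u.
Proof. by rewrite rdotC rdotZl rdotC. Qed.

Lemma rdot0r w : rdot w 0 = 0.
Proof. by apply: big1 => i _; rewrite mxE /= !mulr0 addr0. Qed.

Lemma rdot_sumr (I : Type) (r : seq I) (P : pred I) (F : I -> 'cV[R[i]]_n) w :
  rdot w (\sum_(i <- r | P i) F i) = \sum_(i <- r | P i) rdot w (F i).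
Proof. exact: (big_morph (rdot w) (rdotDr w) (rdot0r w)). Qed.

Lemma rdot_scale_complex (z : R[i]) w u :
  rdot w (z *: u) = Re z * rdot w u + Im z * rdot w ('i%C *: u).
Proof.
have -> : z *: u = (Re z)%:C%C *: u + (Im z)%:C%C *: ('i%C *: u).
  rewrite scalerA -scalerDl; congr (_ *: _).
  by case: z => a b; apply/eqP; rewrite eq_complex /=; apply/andP; split;
     apply/eqP; ring.
by rewrite rdotDr !rdotZr.
Qed.

Lemma normc_sqr (z : R[i]) : Normc.normc z ^+ 2 = Re z * Re z + Im z * Im z.
Proof. by case: z => a b /=; rewrite sqr_sqrtr ?addr_ge0 ?sqr_ge0. Qed.

Lemma enormE v : enorm v = Num.sqrt (rdot v v).
Proof. by congr Num.sqrt; apply: eq_bigr => i _; rewrite normc_sqr. Qed.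

Lemma rdot_ge0 v : 0 <= rdot v v.
Proof. by apply: sumr_ge0 => i _; rewrite -!expr2 addr_ge0 ?sqr_ge0. Qed.

Lemma enorm_sqr v : enorm v ^+ 2 = rdot v v.
Proof. by rewrite enormE sqr_sqrtr ?rdot_ge0. Qed.

Lemma enorm_le u v : (enorm u <= enorm v) = (rdot u u <= rdot v v).
Proof. by rewrite !enormE ler_sqrt ?rdot_ge0. Qed.

Lemma rdot_eq0 v : rdot v v = 0 -> v = 0.
Proof.
move=> /eqP; rewrite psumr_eq0; last first.
  by move=> i _; rewrite -!expr2 addr_ge0 ?sqr_ge0.
move=> /allP v0; apply/colP => i; rewrite mxE.
move: (v0 i (mem_index_enum _)) => /=; rewrite -!expr2.
rewrite paddr_eq0 ?sqr_ge0 // !sqrf_eq0 => /andP[/eqP re0 /eqP im0].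
by apply/eqP; rewrite eq_complex /= re0 im0 eqxx.
Qed.

Definition real_subspace (Q : 'cV[R[i]]_n -> Prop) :=
  Q 0 /\ forall c u v, Q u -> Q v -> Q (c%:C%C *: u + v).

Lemma orthogonal_subspace w : real_subspace (fun u => rdot w u = 0).
Proof.
split=> [|c u v wu wv]; first exact: rdot0r.
by rewrite rdotDr rdotZr wu wv mulr0 addr0.
Qed.

(** Gram-Schmidt on the list [s]: [- y] is the projection of [v] on the real
    span of [s].  The span is described by the real subspaces containing [s],
    which is how membership of [y] is used. *)
Lemma orthogonal_projection (s : seq 'cV[R[i]]_n) v : exists y,
  (forall Q, real_subspace Q -> {in s, forall w, Q w} -> Q y) /\
  {in s, forall w, rdot (v + y) w = 0}.
Proof.
elim: s v => [|w s IHs] v.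
  by exists 0; split=> // Q [].
have [yw [yw_span yw_orth]] := IHs w.
have [y [y_span y_orth]] := IHs v.
(* [w'] is the component of [w] orthogonal to [s]; when it is zero, [c] is
   zero as well, by the convention on division. *)
pose w' := w + yw; pose c := - (rdot (v + y) w' / rdot w' w').
have orth_w' : rdot (v + (c%:C%C *: w' + y)) w' = 0.
  rewrite addrCA rdotDl rdotZl /c.
  have [w'0|w'n0] := eqVneq (rdot w' w') 0.
    by rewrite (rdot_eq0 w'0) !rdot0r; ring.
  by field.
have orth_s : {in s, forall z, rdot (v + (c%:C%C *: w' + y)) z = 0}.
  by move=> z zs; rewrite addrCA rdotDl rdotZl y_orth // yw_orth // mulr0 addr0.
exists (c%:C%C *: w' + y); split.
  move=> Q subQ sQ.
  have sQ' : {in s, forall z, Q z}.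
    by move=> z zs; apply: sQ; rewrite inE zs orbT.
  apply: subQ.2; last exact: y_span.
  rewrite /w' -[w]scale1r; apply: subQ.2; last exact: yw_span.
  by apply: sQ; rewrite mem_head.
move=> z; rewrite inE => /predU1P[->|]; last exact: orth_s.
have := yw_span _ (orthogonal_subspace (v + (c%:C%C *: w' + y))) orth_s.
by move: orth_w'; rewrite {2}/w' rdotDr => + yw0; rewrite yw0 addr0.
Qed.

End RealInnerProduct.

(** * The inner minimum *)

Section Minimum.
Variables (R : realType) (n : nat).
Implicit Types (M : 'M[R[i]]_n.+1) (b : 'cV[R[i]]_n.+1) (K : {pred R[i]}).

Definition real_or_complex K := K = realF R \/ K = cplxF R.

Lemma scalar_in_realF (z : R[i]) : (z \in realF R) = (Im z == 0).
Proof. by case: z => x y; exact: complex_real. Qed.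

Lemma mem_field_lin K (c : R) (x y : R[i]) : real_or_complex K ->
  x \in K -> y \in K -> c%:C%C * x + y \in K.
Proof.
case=> -> //; rewrite !scalar_in_realF.
case: x => x1 x2; case: y => y1 y2 /= /eqP -> /eqP ->.
by rewrite mulr0 mul0r !addr0.
Qed.

Lemma mem_field_real K (c : R) : real_or_complex K -> c%:C%C \in K.
Proof. by case=> -> //; rewrite scalar_in_realF /=. Qed.

Lemma polyOver_fieldP K (p : {poly R[i]}) : real_or_complex K ->
  (p \is a polyOver K) <-> (forall j, p`_j \in K).
Proof.
move=> hK; split=> [/allP Kp j|Kp].
  have [lt_j|le_j] := ltnP j (size p); first by apply: Kp; rewrite mem_nth.
  by rewrite nth_default // (mem_field_real 0 hK).
by apply/allP => x /(nthP 0)[j _ <-]; apply: Kp.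
Qed.

(** Differences of two residual polynomials. *)
Definition increments (k : nat) K : set {poly R[i]} :=
  [set q | [/\ forall j, q`_j \in K, (size q <= k.+1)%N & q`_0 = 0]].

Lemma increments_lin k K (c : R) (p q : {poly R[i]}) : real_or_complex K ->
  increments k K p -> increments k K q ->
  increments k K (c%:C%C *: p + q).
Proof.
move=> hK [Kp sp p0] [Kq sq q0]; split.
- by move=> j; rewrite coefD coefZ mem_field_lin.
- rewrite (leq_trans (size_polyD _ _)) // geq_max sq andbT.
  exact: leq_trans (size_scale_leq _ _) sp.
- by rewrite coefD coefZ p0 q0 mulr0 addr0.
Qed.

Lemma increments0 k K : real_or_complex K -> increments k K 0.
Proof.
move=> hK; split=> [j||]; rewrite ?coef0 ?size_poly0 //.
exact: (mem_field_real 0 hK).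
Qed.

Lemma residual_incrementP k K (p : {poly R[i]}) : real_or_complex K ->
  residual_polys k K p <-> increments k K (p - 1).
Proof.
move=> hK; have K1 : 1 \in K := mem_field_real 1 hK.
have split_sub (x y : R[i]) : x - y = (-1)%:C%C * y + x.
  by rewrite rmorphN1 mulN1r addrC.
split=> [[/(polyOver_fieldP _ hK) Kp sp p1]|[Kq sq q0]].
  split.
  - move=> j; rewrite coefB split_sub mem_field_lin // coef1.
    by case: eqP => _; rewrite ?K1 // (mem_field_real 0 hK).
  - rewrite (leq_trans (size_polyD _ _)) // geq_max sp size_polyN size_poly1.
    by [].
  - by rewrite coefB coef1 /= -horner_coef0 p1 subrr.
rewrite -[p](subrK 1); split.
- apply/(polyOver_fieldP _ hK) => j; rewrite coefD -[_`_j]mul1r.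
  apply: (mem_field_lin 1) => //; rewrite coef1.
  by case: eqP => _; rewrite ?K1 // (mem_field_real 0 hK).
- by rewrite (leq_trans (size_polyD _ _)) // geq_max sq size_poly1.
- by rewrite hornerD hornerC horner_coef0 q0 add0r.
Qed.

Lemma increment_expand M k K (q : {poly R[i]}) : increments k K q ->
  horner_mx M q = \sum_(j < k) q`_j.+1 *: M ^+ j.+1.
Proof.
case=> _ sq q0.
have -> : q = \sum_(j < k) q`_j.+1 *: 'X^(j.+1).
  have {1}-> : q = \poly_(j < k.+1) q`_j.
    apply/polyP => j; rewrite coef_poly; case: ltnP => // lt_kj.
    by rewrite nth_default // (leq_trans sq).
  by rewrite poly_def big_ord_recl q0 scale0r add0r.
rewrite rmorph_sum; apply: eq_bigr => j _.
by rewrite /= linearZ /= rmorphXn /= horner_mx_X coef_sum; congr (_ *: _);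
   under eq_bigr do rewrite coefZ coefXn; rewrite (bigD1 j) //= eqxx mulr1
     big1 ?addr0 // => i /negPf ne_ij; rewrite eqSS eq_sym [_ == _]ne_ij mulr0.
Qed.

Lemma increment_monomial k K (z : R[i]) j : real_or_complex K ->
  z \in K -> (j < k)%N -> increments k K (z *: 'X^(j.+1)).
Proof.
move=> hK Kz lt_jk; split=> [i||].
- rewrite coefZ coefXn; case: eqP => _; first by rewrite mulr1.
  by rewrite mulr0 (mem_field_real 0 hK).
- by rewrite (leq_trans (size_scale_leq _ _)) // size_polyXn.
- by rewrite coefZ coefXn mulr0.
Qed.

(** The vectors [q(M)b] are in the real span of the [M^j b], together with
    the [i M^j b] when [i] is an admissible coefficient. *)
Lemma increment_orthogonal k K M b v : real_or_complex K ->
  (forall j, (j < k)%N -> rdot v (M ^+ j.+1 *m b) = 0) ->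
  ('i%C \in K ->
     forall j, (j < k)%N -> rdot v ('i%C *: (M ^+ j.+1 *m b)) = 0) ->
  forall q, increments k K q -> rdot v (horner_mx M q *m b) = 0.
Proof.
move=> hK orth_re orth_im q Kq.
rewrite (increment_expand M Kq) mulmx_suml rdot_sumr big1 // => j _.
rewrite -scalemxAl rdot_scale_complex orth_re // mulr0 add0r.
case: Kq => /(_ j.+1) + _ _; case: hK => hK.
  by rewrite hK scalar_in_realF => /eqP ->; rewrite mul0r.
by rewrite orth_im ?mulr0 // hK.
Qed.

(** The optimal residual is characterised by its orthogonality to all
    admissible increments. *)
Lemma minimal_residual k K M b : real_or_complex K ->
  exists2 p, residual_polys k K p &
    forall q, increments k K q ->
      rdot (horner_mx M p *m b) (horner_mx M q *m b) = 0.
Proof.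
move=> hK.
pose units := if 'i%C \in K then [:: 1; 'i%C : R[i]] else [:: 1].
have unitsK z : z \in units -> z \in K.
  rewrite /units; case: ifP => [Ki|_]; rewrite !inE; last first.
    by move=> /eqP ->; apply: (mem_field_real 1 hK).
  by case/orP => /eqP -> //; apply: (mem_field_real 1 hK).
pose s := [seq z *: (M ^+ j.+1 *m b) | z <- units, j <- iota 0 k].
have [y [y_span y_orth]] := orthogonal_projection s b.
have [q0 Kq0 y_def] : exists2 q, increments k K q & y = horner_mx M q *m b.
  apply: (y_span (fun u =>
    exists2 q, increments k K q & u = horner_mx M q *m b)).
    split=> [|c u v [p Kp ->] [q Kq ->]].
      by exists 0; [exact: increments0 | rewrite rmorph0 mul0mx].
    exists (c%:C%C *: p + q); first exact: increments_lin.
    by rewrite rmorphD /= linearZ mulmxDl scalemxAl.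
  move=> _ /allpairsP[[z j] /= [/unitsK Kz + ->]]; rewrite mem_iota => lt_jk.
  exists (z *: 'X^(j.+1)); first exact: increment_monomial.
  by rewrite linearZ /= rmorphXn /= horner_mx_X scalemxAl.
exists (1 + q0).
  by apply/(residual_incrementP _ _ hK); rewrite addrAC subrr add0r.
rewrite rmorphD rmorph1 mulmxDl mul1mx -y_def.
apply: increment_orthogonal => // [j lt_jk|Ki j lt_jk].
  apply: y_orth; rewrite -[_ *m _]scale1r; apply: allpairs_f.
    by rewrite /units; case: ifP; rewrite !inE eqxx.
  by rewrite mem_iota.
apply: y_orth; apply: allpairs_f; last by rewrite mem_iota.
by rewrite /units Ki !inE eqxx orbT.
Qed.

Definition residual_norms k K M b : set R :=
  [set enorm (horner_mx M p *m b) | p in residual_polys k K].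

Lemma pythagoras k K M b (p q : {poly R[i]}) : real_or_complex K ->
  residual_polys k K p -> residual_polys k K q ->
  (forall r, increments k K r ->
     rdot (horner_mx M p *m b) (horner_mx M r *m b) = 0) ->
  enorm (horner_mx M p *m b) <= enorm (horner_mx M q *m b).
Proof.
move=> hK Kp Kq orth_p.
have Kr : increments k K (q - p).
  have /residual_incrementP-/(_ hK) Kp' := Kp.
  have /residual_incrementP-/(_ hK) Kq' := Kq.
  have -> : q - p = (-1)%:C%C *: (p - 1) + (q - 1).
    by rewrite rmorphN1 scaleN1r; ring.
  exact: increments_lin.
rewrite enorm_le; have -> : q = p + (q - p) by rewrite addrC subrK.
rewrite rmorphD mulmxDl rdotDl !rdotDr /=.
have orth_pq := orth_p _ Kr; rewrite (rdotC (horner_mx M (q - p) *m b)) orth_pq.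
by rewrite addr0 add0r lerDl rdot_ge0.
Qed.

Lemma set_minP (S : set R) m : S m -> lbound S m -> set_min S = m.
Proof.
move=> Sm lbm; have [Sx lbx] : S (set_min S) /\ lbound S (set_min S).
  by apply: (@xgetPex _ 0 [set x | S x /\ lbound S x]%classic); exists m.
by apply/eqP; rewrite eq_le lbx //= lbm.
Qed.

Lemma set_maxP (S : set R) m : S m -> ubound S m -> set_max S = m.
Proof.
move=> Sm ubm; have [Sx ubx] : S (set_max S) /\ ubound S (set_max S).
  by apply: (@xgetPex _ 0 [set x | S x /\ ubound S x]%classic); exists m.
by apply/eqP; rewrite eq_le ubm //= ubx.
Qed.

Lemma set_min_residual k K M b : real_or_complex K ->
  residual_norms k K M b (set_min (residual_norms k K M b)) /\
  lbound (residual_norms k K M b) (set_min (residual_norms k K M b)).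
Proof.
move=> hK; have [p Kp orth_p] := minimal_residual k M b hK.
have lbp : lbound (residual_norms k K M b) (enorm (horner_mx M p *m b)).
  by move=> _ [q Kq <-]; apply: pythagoras orth_p.
have Sp : residual_norms k K M b (enorm (horner_mx M p *m b)) by exists p.
by rewrite (set_minP Sp lbp).
Qed.

End Minimum.

(** * The outer maximum *)

Section Maximum.
Variable R : realType.

Lemma seq_argmax (T : eqType) (f : T -> R) (s : seq T) : s != [::] ->
  exists2 x, x \in s & {in s, forall y, f y <= f x}.
Proof.
elim: s => // x [|y s] IHs _.
  by exists x; rewrite ?mem_head // => z; rewrite inE => /eqP ->.
have [//|z zs z_max] := IHs.
have [le_xz|/ltW le_zx] := leP (f x) (f z).
  exists z; first by rewrite inE zs orbT.
  by move=> t; rewrite inE => /predU1P[-> //|]; apply: z_max.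
exists x; first exact: mem_head.
move=> t; rewrite inE => /predU1P[-> //|/z_max le_tz].
exact: le_trans le_tz le_zx.
Qed.

(** An infimum of continuous functions is upper semicontinuous, so it reaches
    its maximum on a compact set.  If no point were maximal, the open sets
    [U y], on which [f] is below [f y], would cover [S]; the best of the
    finitely many [y] of a subcover would lie in some [U z] of the subcover,
    and so would not be the best. *)
Lemma min_family_attains_max (T : ptopologicalType) (P : Type) (S : set T)
    (D : set P) (g : P -> T -> R) (f : T -> R) :
  compact S -> (S !=set0)%classic ->
  (forall p, D p -> continuous (g p)) ->
  (forall x, S x -> exists2 p, D p & g p x = f x) ->
  (forall x p, S x -> D p -> f x <= g p x) ->
  exists2 x, S x & forall y, S y -> f y <= f x.
Proof.
move=> cptS [x0 Sx0] g_cont f_att f_min; apply: contrapT => no_max.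
have better x : S x -> exists2 y, S y & f x < f y.
  move=> Sx; apply: contrapT => no_y; apply: no_max; exists x => // y Sy.
  by rewrite leNgt; apply/negP => lt_xy; apply: no_y; exists y.
pose U y : set T := [set x | exists2 p, D p & g p x < f y]%classic.
move: cptS; rewrite compact_cover => /(_ _ S U).
case.
- move=> y _; have -> : U y = (\bigcup_(p in D) [set x | g p x < f y])%classic.
    by apply/seteqP; split=> x [p Dp lt_p]; exists p.
  apply: bigcup_open => p Dp.
  apply: (@open_comp _ _ (g p) [set t | t < f y]%classic).
    by move=> x _; apply: g_cont.
  exact: open_lt.
- move=> x Sx; have [y Sy lt_xy] := better x Sx; exists y => //.
  by have [p Dp gp] := f_att x Sx; exists p; rewrite ?gp.
move=> D' sub_D' cov.
have D'_neq0 : finmap.enum_fset D' != [::].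
  by have [y D'y _] := cov _ Sx0; apply/eqP => D'0; move: D'y;
  rewrite /= -[y \in D']/(y \in finmap.enum_fset D') D'0.
have [y D'y y_max] := seq_argmax f D'_neq0.
have Sy : S y by exact: set_mem (sub_D' _ D'y).
have [z D'z [p Dp lt_p]] := cov _ Sy.
by have := le_lt_trans (f_min _ _ Sy Dp) lt_p; rewrite ltNge y_max.
Qed.

Lemma continuous_sum (T : topologicalType) (I : finType) (f : I -> T -> R) :
  (forall i, continuous (f i)) -> continuous (fun x => \sum_i f i x).
Proof.
move=> f_cont; elim: (index_enum I) => [|i r IHr].
  by under [X in continuous X]funext do rewrite big_nil; exact: cst_continuous.
under [X in continuous X]funext do rewrite big_cons.
by move=> x; apply: continuousD; [exact: f_cont | exact: IHr].
Qed.

Lemma continuous_comb (T : topologicalType) (f g : T -> R) (a b : R) :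
  continuous f -> continuous g -> continuous (fun x => a * f x + b * g x).
Proof.
move=> f_cont g_cont x.
apply: (@continuousD _ _ _ (fun x => a * f x) (fun x => b * g x));
  apply: continuousM;
  by [exact: cst_continuous | exact: f_cont | exact: g_cont].
Qed.

Lemma continuous_sqr (T : topologicalType) (f : T -> R) :
  continuous f -> continuous (fun x => f x * f x).
Proof. by move=> f_cont x; apply: continuousM; exact: f_cont. Qed.

Section Coordinates.
Variable n : nat.
Implicit Types (x : 'rV[R]_(n + n)) (v : 'cV[R[i]]_n).

Definition to_complex x : 'cV[R[i]]_n :=
  \col_i (x 0 (lshift n i) +i* x 0 (rshift n i))%C.

Definition to_real v : 'rV[R]_(n + n) :=
  row_mx (\row_i Re (v i 0)) (\row_i Im (v i 0)).

Lemma to_realK v : to_complex (to_real v) = v.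
Proof.
apply/colP => i; rewrite !mxE (unsplitK (inl _ i)) (unsplitK (inr _ i)) !mxE.
by case: (v i 0).
Qed.

Lemma continuous_rdot_mul (M : 'M[R[i]]_n) :
  continuous (fun x => rdot (M *m to_complex x) (M *m to_complex x)).
Proof.
have coord i : continuous (fun x : 'rV[R]_(n + n) => x 0 i).
  exact: coord_continuous.
have reE x i : Re ((M *m to_complex x) i 0) =
    \sum_j (Re (M i j) * x 0 (lshift n j) + - Im (M i j) * x 0 (rshift n j)).
  rewrite mxE (raddf_sum (@complex.Re R : Rcomplex R -> R)).
  by apply: eq_bigr => j _; rewrite mxE; case: (M i j) => a b /=; ring.
have imE x i : Im ((M *m to_complex x) i 0) =
    \sum_j (Re (M i j) * x 0 (rshift n j) + Im (M i j) * x 0 (lshift n j)).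
  rewrite mxE (raddf_sum (@complex.Im R : Rcomplex R -> R)).
  by apply: eq_bigr => j _; rewrite mxE; case: (M i j) => a b /=; ring.
apply: continuous_sum => i.
under [X in continuous X]funext => x.
  rewrite reE imE -[X in X + _]mul1r -[X in _ + X]mul1r; over.
by apply: continuous_comb; apply: continuous_sqr; apply: continuous_sum => j;
  apply: continuous_comb; exact: coord.
Qed.

(** Compactness is obtained in the real coordinates; for real vectors the
    coordinates giving the imaginary parts are required to vanish. *)
Lemma closed_real_sphere F : real_or_complex F ->
  closed [set x | unit_sphere n F (to_complex x)].
Proof.
move=> hF.
have cont_coord j : continuous (fun x : 'rV[R]_(n + n) => x 0 j).
  exact: coord_continuous.
have closed_norm : closed [set x | rdot (to_complex x) (to_complex x) = 1].
  have -> : [set x | rdot (to_complex x) (to_complex x) = 1]%classic =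
      ((fun x => rdot (1%:M *m to_complex x) (1%:M *m to_complex x)) @^-1`
        [set t | t = 1])%classic.
    by apply/seteqP; split=> x /=; rewrite mul1mx.
  apply: preimage_closed => [x _|]; last exact: closed_eq.
  exact: continuous_rdot_mul.
have closed_field : closed [set x | to_complex x \is a mxOver F].
  case: hF => ->.
    have -> : [set x | to_complex x \is a mxOver (realF R)]%classic =
        (\bigcap_(i in [set: 'I_n]) ((fun x => x 0 (rshift n i)) @^-1`
           [set t | t = 0]))%classic.
      apply/seteqP; split=> [x /mxOverP Fx i _|x x0] /=.
        by have := Fx i 0; rewrite mxE scalar_in_realF => /eqP.
      apply/mxOverP => i j; rewrite mxE scalar_in_realF /=; apply/eqP.
      exact: (x0 i).
    apply: closed_bigI => i _.
    by apply: preimage_closed => [x _|]; [exact: cont_coord | exact: closed_eq].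
  have -> : [set x | to_complex x \is a mxOver (cplxF R)]%classic = setT.
    by apply/seteqP; split=> x //= _; apply/mxOverP.
  exact: closedT.
have -> : [set x | unit_sphere n F (to_complex x)]%classic =
    ([set x | rdot (to_complex x) (to_complex x) = 1] `&`
     [set x | to_complex x \is a mxOver F])%classic.
  apply/seteqP; split=> x /= [].
    by move=> Fx norm1; split=> //; rewrite -enorm_sqr norm1 expr1n.
  by move=> norm1 Fx; split=> //; rewrite enormE norm1 sqrtr1.
exact: closedI.
Qed.

Lemma compact_real_sphere F : real_or_complex F ->
  compact [set x | unit_sphere n F (to_complex x)].
Proof.
move=> hF; apply: bounded_closed_compact; last exact: closed_real_sphere.
exists 1; split; first exact: num_real.
move=> r /ltW le_1r x /= [_ norm1]; apply: le_trans le_1r.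
have {}norm1 : \sum_i (x 0 (lshift n i) ^+ 2 + x 0 (rshift n i) ^+ 2) = 1.
  rewrite -[RHS](expr1n _ 2) -norm1 enorm_sqr.
  by apply: eq_bigr => i _; rewrite !mxE.
have coord_le1 j : `|x 0 j| <= 1.
  rewrite -(@expr_le1 _ 2) // real_normK ?num_real // -norm1 -[j]splitK.
  have tail_ge0 i : 0 <= \sum_(l < n | l != i)
      (x 0 (lshift n l) ^+ 2 + x 0 (rshift n l) ^+ 2).
    by apply: sumr_ge0 => l _; rewrite addr_ge0 ?sqr_ge0.
  by case: (split j) => i /=; rewrite (bigD1 i) //= -?addrA ?lerDl //;
    rewrite ?addr_ge0 ?sqr_ge0 // addrCA lerDl addr_ge0 ?sqr_ge0.
rewrite [leLHS]/Num.norm /= mx_normrE; apply: bigmax_le => // -[i j] _ /=.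
by rewrite ord1.
Qed.

End Coordinates.

Lemma unit_sphere_nonempty n (F : {pred R[i]}) : real_or_complex F ->
  exists v, @unit_sphere R n.+1 F v.
Proof.
move=> hF; exists (delta_mx 0 0); split.
  apply/mxOverP => i j; rewrite mxE; case: (_ && _).
    exact: (mem_field_real 1 hF).
  exact: (mem_field_real 0 hF).
rewrite enormE /rdot (bigD1 ord0) //= big1 => [|i /negPf ne_i0].
  by rewrite !mxE !eqxx /= !mul1r !mul0r !addr0 sqrtr1.
by rewrite !mxE ne_i0 /= !mul0r addr0.
Qed.

Lemma Psi_attained n k (K F : {pred R[i]}) (A : 'M[R]_n.+1) :
  real_or_complex K -> real_or_complex F ->
  exists b, [/\ unit_sphere n.+1 F b,
    Psi k K F A = set_min (residual_norms k K (cmx A) b) &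
    forall c, unit_sphere n.+1 F c ->
      set_min (residual_norms k K (cmx A) c) <= Psi k K F A].
Proof.
move=> hK hF.
pose f b := set_min (residual_norms k K (cmx A) b).
pose g (p : {poly R[i]}) (x : 'rV[R]_(n.+1 + n.+1)) :=
  let r := horner_mx (cmx A) p *m to_complex x in rdot r r.
have f_ge0 b : 0 <= f b.
  rewrite /f; have [[p _ <-] _] := set_min_residual k (cmx A) b hK.
  exact: sqrtr_ge0.
have [||||x Sx x_max] := @min_family_attains_max _ _ _ (residual_polys k K)
    g (fun x => f (to_complex x) ^+ 2) (compact_real_sphere hF).
- have [v Fv] := unit_sphere_nonempty n hF.
  by exists (to_real v); rewrite /= to_realK.
- by move=> p _; apply: continuous_rdot_mul.
- move=> x _; rewrite /f.
  have [[p Kp <-] _] := set_min_residual k (cmx A) (to_complex x) hK.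
  by exists p; rewrite // enorm_sqr.
- move=> x p _ Kp; have [_ lb] := set_min_residual k (cmx A) (to_complex x) hK.
  rewrite /g -enorm_sqr lerXn2r ?nnegrE ?f_ge0 ?sqrtr_ge0 //.
  by apply: lb; exists p.
have f_max c : unit_sphere n.+1 F c -> f c <= f (to_complex x).
  move=> Fc; rewrite -(@ler_pXn2r _ 2) ?nnegrE ?f_ge0 //.
  by have := x_max (to_real c); rewrite /= to_realK; apply.
have PsiE : Psi k K F A = f (to_complex x).
  by apply: set_maxP => [|_ [c Fc <-]]; [exists (to_complex x) | exact: f_max].
by exists (to_complex x); split; rewrite ?PsiE.
Qed.

End Maximum.

(** * Comparing the four quantities *)

Section Comparison.
Variables (R : realType) (n : nat).
Implicit Types (A B : 'M[R]_n.+1) (b : 'cV[R[i]]_n.+1) (K F : {pred R[i]}).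

Lemma realFP : real_or_complex (realF R). Proof. by left. Qed.
Lemma cplxFP : real_or_complex (cplxF R). Proof. by right. Qed.
Hint Resolve realFP cplxFP : core.

Definition im_free (u : 'cV[R[i]]_n.+1) := forall i, Im (u i 0) = 0.

Lemma im_free_cmx B u : im_free u -> im_free (cmx B *m u).
Proof.
move=> u0 i; rewrite mxE (raddf_sum (@complex.Im R : Rcomplex R -> R)) big1 //.
by move=> j _; rewrite mxE /=; have := u0 j; case: (u j 0) => x y /= ->; ring.
Qed.

Lemma cmxX A j : cmx A ^+ j = cmx (A ^+ j).
Proof. by rewrite /cmx rmorphXn. Qed.

Lemma rdot_im_free u v : im_free u -> im_free v -> rdot u ('i%C *: v) = 0.
Proof.
move=> u0 v0; apply: big1 => i _; rewrite mxE u0.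
by have := v0 i; case: (v i 0) => x y /= ->; ring.
Qed.

(** The optimal residual over the reals is itself a real vector, and the
    vectors [i A^j b] are orthogonal to real vectors. *)
Lemma set_min_real_vector k A b : im_free b ->
  set_min (residual_norms k (realF R) (cmx A) b) =
  set_min (residual_norms k (cplxF R) (cmx A) b).
Proof.
move=> b0; have [p Kp orth_p] := minimal_residual k (cmx A) b realFP.
have sub_poly q : residual_polys k (realF R) q -> residual_polys k (cplxF R) q.
  by case=> _ sq q1; split=> //; apply/(polyOver_fieldP _ cplxFP).
have p_im_free : im_free (horner_mx (cmx A) p *m b).
  have /residual_incrementP-/(_ realFP) Kq := Kp.
  rewrite -[p](subrK 1) rmorphD rmorph1 mulmxDl mul1mx /=.
  rewrite (increment_expand _ Kq).
  move=> i; rewrite mxE mulmx_suml summxE.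
  rewrite (raddfD (@complex.Im R : Rcomplex R -> R)) /= b0 addr0.
  rewrite (raddf_sum (@complex.Im R : Rcomplex R -> R)) big1 // => j _.
  have := im_free_cmx (A ^+ j.+1) b0 i; rewrite -scalemxAl cmxX.
  case: Kq => /(_ j.+1) + _ _; rewrite scalar_in_realF => /eqP.
  rewrite [(_ *: _ : 'cV_n.+1) i 0]mxE; case: (_`_ _) => x y /= ->.
  by case: ((_ *m _ : 'cV_n.+1) i 0) => x' y' /= ->; ring.
rewrite (@set_minP _ _ (enorm (horner_mx (cmx A) p *m b))); last 2 first.
- by exists p.
- by move=> _ [q Kq <-]; apply: pythagoras orth_p.
rewrite (@set_minP _ _ (enorm (horner_mx (cmx A) p *m b))) //.
- by exists p => //; apply: sub_poly.
- move=> _ [q Kq <-]; apply: (pythagoras cplxFP (sub_poly _ Kp) Kq).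
  apply: increment_orthogonal => // [j lt_jk|_ j lt_jk].
    rewrite -[_ *m b]scale1r; have := @increment_monomial _ k _ 1 j realFP.
    move=> /(_ (mem_field_real 1 realFP) lt_jk) /orth_p.
    by rewrite linearZ /= rmorphXn /= horner_mx_X scalemxAl.
  by rewrite cmxX rdot_im_free // ; apply: im_free_cmx.
Qed.

Lemma Psi_real_vectors k A :
  Psi k (realF R) (realF R) A = Psi k (cplxF R) (realF R) A.
Proof.
congr set_max; apply: eq_imagel => b [Fb _]; apply: set_min_real_vector => i.
by move/mxOverP: Fb => /(_ i 0); rewrite scalar_in_realF => /eqP.
Qed.

Lemma Psi_vectors_mono k K F F' A :
  real_or_complex K -> real_or_complex F -> real_or_complex F' ->
  {subset F <= F'} -> Psi k K F A <= Psi k K F' A.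
Proof.
move=> hK hF hF' sFF'; have [b [[Fb norm1] -> _]] := Psi_attained k A hK hF.
have [_ [_ _]] := Psi_attained k A hK hF'; apply; split=> //.
by apply/mxOverP => i j; apply: sFF'; move/mxOverP: Fb; apply.
Qed.

Lemma Psi_coefficients_anti k K K' F A :
  real_or_complex K -> real_or_complex K' -> real_or_complex F ->
  {subset K' <= K} -> Psi k K F A <= Psi k K' F A.
Proof.
move=> hK hK' hF sK'K; have [b [Fb -> _]] := Psi_attained k A hK hF.
have [_ [_ _ /(_ b Fb)]] := Psi_attained k A hK' hF; apply: le_trans.
have [_ lb] := set_min_residual k (cmx A) b hK.
have [[p [Kp sp p1] <-] _] := set_min_residual k (cmx A) b hK'.
apply: lb; exists p => //; split=> //; apply/(polyOver_fieldP _ hK) => j.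
by apply: sK'K; move/(polyOver_fieldP _ hK'): Kp.
Qed.

End Comparison.

(** * Stagnation *)

Section Stagnation.
Variables (R : realType) (n : nat).
Implicit Types (A B : 'M[R]_n.+1) (b : 'cV[R[i]]_n.+1) (K F : {pred R[i]}).

(** The best residual polynomial is the constant [1]. *)
Definition stagnates k K A b :=
  forall q, increments k K q -> rdot b (horner_mx (cmx A) q *m b) = 0.

Lemma residual_polys1 k K : real_or_complex K -> residual_polys k K 1.
Proof.
move=> hK; apply/(residual_incrementP _ _ hK); rewrite subrr.
exact: increments0.
Qed.

Lemma set_min_stagnates k K A b : real_or_complex K -> enorm b = 1 ->
  stagnates k K A b -> set_min (residual_norms k K (cmx A) b) = 1.
Proof.
move=> hK norm1 stag; apply: set_minP.
  by exists 1; [exact: residual_polys1 | rewrite rmorph1 mul1mx].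
have bE : horner_mx (cmx A) 1 *m b = b by rewrite rmorph1 mul1mx.
move=> _ [q Kq <-]; rewrite -norm1 -{1}bE.
by apply: (pythagoras hK (residual_polys1 k hK) Kq); rewrite bE.
Qed.

(** If [b] were not orthogonal to [v = q(A)b], a small real multiple of [v]
    added to [b] would shorten it. *)
Lemma stagnates_set_min k K A b : real_or_complex K -> enorm b = 1 ->
  1 <= set_min (residual_norms k K (cmx A) b) -> stagnates k K A b.
Proof.
move=> hK norm1 ge1 q Kq; set v := _ *m b.
(* This [c] minimises [|b + c v|], up to the summand 1 that avoids a division
   by zero. *)
pose c := - (rdot b v / (1 + rdot v v)).
have [_ lb] := set_min_residual k (cmx A) b hK.
have : 1 <= enorm (b + c%:C%C *: v).
  apply: le_trans ge1 _; apply: lb; exists (1 + c%:C%C *: q).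
    apply/(residual_incrementP _ _ hK).
    rewrite addrAC subrr add0r -[_ *: q]addr0.
    by apply: increments_lin => //; apply: increments0.
  by rewrite rmorphD rmorph1 /= linearZ mulmxDl mul1mx scalemxAl.
have s_ge0 := rdot_ge0 v; have s1_gt0 : 0 < 1 + rdot v v by lra.
rewrite -(@ler_pXn2r _ 2) ?nnegrE ?sqrtr_ge0 // expr1n enorm_sqr.
rewrite rdotDl !rdotDr !rdotZl !rdotZr -enorm_sqr norm1 (rdotC v b) => ge1'.
have cE : c * (1 + rdot v v) = - rdot b v by rewrite /c; field; lra.
by apply/eqP; rewrite -sqrf_eq0 eq_le sqr_ge0 andbT; nra.
Qed.

Lemma Psi_ge1 k K F A b : real_or_complex K -> real_or_complex F ->
  b \is a mxOver F -> b != 0 -> stagnates k K A b -> 1 <= Psi k K F A.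
Proof.
move=> hK hF Fb b_neq0 stag.
have norm_gt0 : 0 < enorm b.
  rewrite lt_neqAle sqrtr_ge0 andbT eq_sym -sqrf_eq0 enorm_sqr.
  by apply: contra b_neq0 => /eqP/rdot_eq0/eqP.
pose c := (enorm b)^-1; pose u := c%:C%C *: b.
have Fu : u \is a mxOver F.
  apply/mxOverP => i j; rewrite mxE -[_ * _]addr0; apply: mem_field_lin => //.
    by move/mxOverP: Fb; apply.
  exact: (mem_field_real 0 hF).
have norm1 : enorm u = 1.
  rewrite enormE rdotZl rdotZr -enorm_sqr mulrA expr2.
  have -> : c * c * (enorm b * enorm b) = 1 by rewrite /c; field; lra.
  by rewrite sqrtr1.
have stag_u : stagnates k K A u.
  by move=> q Kq; rewrite -scalemxAr rdotZl rdotZr stag // !mulr0.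
have [_ [_ _ /(_ u)]] := Psi_attained k A hK hF.
by rewrite (set_min_stagnates hK norm1 stag_u); apply.
Qed.

Lemma Psi_lt1 k K F A : real_or_complex K -> real_or_complex F ->
  (forall b, b \is a mxOver F -> stagnates k K A b -> b = 0) ->
  Psi k K F A < 1.
Proof.
move=> hK hF no_stag; have [b [[Fb norm1] -> _]] := Psi_attained k A hK hF.
rewrite ltNge; apply/negP => ge1.
have b0 := no_stag b Fb (stagnates_set_min hK norm1 ge1).
by move/eqP: norm1; rewrite enormE b0 rdot0r sqrtr0 eq_sym oner_eq0.
Qed.

(** [form_re B b] and [- form_im B b] are the real and imaginary parts of
    [b* B b]. *)
Definition form_re B b : R := \sum_i \sum_j
  B i j * (Re (b i 0) * Re (b j 0) + Im (b i 0) * Im (b j 0)).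

Definition form_im B b : R := \sum_i \sum_j
  B i j * (Im (b i 0) * Re (b j 0) - Re (b i 0) * Im (b j 0)).

Lemma rdot_cmx B b : rdot b (cmx B *m b) = form_re B b.
Proof.
apply: eq_bigr => i _; rewrite mxE.
rewrite (raddf_sum (@complex.Re R : Rcomplex R -> R)).
rewrite (raddf_sum (@complex.Im R : Rcomplex R -> R)) !mulr_sumr -big_split.
by apply: eq_bigr => j _; rewrite mxE; case: (b j 0) => x y /=; ring.
Qed.

Lemma rdot_i_cmx B b : rdot b ('i%C *: (cmx B *m b)) = form_im B b.
Proof.
apply: eq_bigr => i _; rewrite !mxE mulr_sumr.
rewrite (raddf_sum (@complex.Re R : Rcomplex R -> R)).
rewrite (raddf_sum (@complex.Im R : Rcomplex R -> R)) !mulr_sumr -big_split.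
by apply: eq_bigr => j _; rewrite mxE; case: (b j 0) => x y /=; ring.
Qed.

Lemma stagnates_real k A b :
  stagnates k (realF R) A b <->
  forall j, (j < k)%N -> form_re (A ^+ j.+1) b = 0.
Proof.
split=> [stag j lt_jk|forms0].
  rewrite -rdot_cmx -cmxX.
  have K1 := mem_field_real 1 (realFP R).
  have := stag _ (increment_monomial (realFP R) K1 lt_jk).
  by rewrite scale1r rmorphXn /= horner_mx_X.
apply: increment_orthogonal; [exact: realFP| |].
  by move=> j lt_jk; rewrite cmxX rdot_cmx forms0.
by rewrite scalar_in_realF /= oner_eq0.
Qed.

Lemma stagnates_complex k A b :
  stagnates k (cplxF R) A b <->
  forall j, (j < k)%N ->
    form_re (A ^+ j.+1) b = 0 /\ form_im (A ^+ j.+1) b = 0.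
Proof.
split=> [stag j lt_jk|forms0].
  rewrite -rdot_cmx -rdot_i_cmx -cmxX.
  have mono z := stag _ (@increment_monomial _ _ _ z _ (cplxFP R) isT lt_jk).
  split; first by have := mono 1; rewrite scale1r rmorphXn /= horner_mx_X.
  by have := mono 'i%C; rewrite linearZ /= rmorphXn /= horner_mx_X scalemxAl.
apply: increment_orthogonal; [exact: cplxFP| |].
  by move=> j lt_jk; rewrite cmxX rdot_cmx; apply: (forms0 j lt_jk).1.
by move=> _ j lt_jk; rewrite cmxX rdot_i_cmx; apply: (forms0 j lt_jk).2.
Qed.

(** A minimal polynomial of lower degree can be multiplied by a power of the
    indeterminate to reach degree [d]. *)
Lemma degree_mxminpoly_gt d A :
  (forall p, p \is monic -> size p = d.+1 -> horner_mx A p != 0) ->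
  (d < degree_mxminpoly A)%N.
Proof.
move=> no_p; rewrite ltnNge; apply/negP => le_d.
pose p := mxminpoly A * 'X^(d - degree_mxminpoly A).
have p_monic : p \is monic by rewrite monicMr ?monicXn ?mxminpoly_monic.
have size_p : size p = d.+1.
  rewrite size_Mmonic ?monicXn ?monic_neq0 ?mxminpoly_monic //.
  by rewrite size_mxminpoly size_polyXn addSn addnS /= subnKC.
have /negP := no_p p p_monic size_p; apply.
by rewrite rmorphM /= mx_root_minpoly mul0r.
Qed.

End Stagnation.

(** * Matrices of order four *)

Section OrderFour.
Variable R : realType.

Definition mx4 (s : seq (seq R)) : 'M[R]_4 :=
  \matrix_(i, j) nth 0 (nth [::] s i) j.

Definition sum4 (F : nat -> R) : R := F 0%N + F 1%N + F 2%N + F 3%N.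

Lemma sum4E (F : 'I_4 -> R) : \sum_i F i = sum4 (fun j => F (inord j)).
Proof.
rewrite !big_ord_recr big_ord0 /= add0r.
by do !congr (_ + _); congr F; apply/val_inj; rewrite /= inordK.
Qed.

Lemma mx4M s t : mx4 s *m mx4 t = mx4
  [seq [seq sum4 (fun k => nth 0 (nth [::] s i) k * nth 0 (nth [::] t k) j)
       | j <- iota 0 4] | i <- iota 0 4].
Proof.
apply/matrixP => i j; rewrite !mxE (nth_map 0%N) ?size_iota //.
rewrite (nth_map 0%N) ?size_iota // !nth_iota // !add0n sum4E.
by rewrite /sum4 !mxE !inordK.
Qed.

Lemma mx4E s i j : (i < 4)%N -> (j < 4)%N ->
  mx4 s (inord i) (inord j) = nth 0 (nth [::] s i) j.
Proof. by move=> lt_i lt_j; rewrite mxE !inordK. Qed.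

Lemma form_re_mx4 s (b : 'cV[R[i]]_4) : form_re (mx4 s) b =
  sum4 (fun i => sum4 (fun j => nth 0 (nth [::] s i) j *
    (Re (b (inord i) 0) * Re (b (inord j) 0) +
     Im (b (inord i) 0) * Im (b (inord j) 0)))).
Proof. by rewrite /form_re !sum4E /sum4 !sum4E /sum4 !mx4E. Qed.

Lemma form_im_mx4 s (b : 'cV[R[i]]_4) : form_im (mx4 s) b =
  sum4 (fun i => sum4 (fun j => nth 0 (nth [::] s i) j *
    (Im (b (inord i) 0) * Re (b (inord j) 0) -
     Re (b (inord i) 0) * Im (b (inord j) 0)))).
Proof. by rewrite /form_im !sum4E /sum4 !sum4E /sum4 !mx4E. Qed.

Lemma col4_eq0 (b : 'cV[R[i]]_4) :
  (forall j, (j < 4)%N -> Re (b (inord j) 0) = 0 /\ Im (b (inord j) 0) = 0) ->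
  b = 0.
Proof.
move=> b0; apply/colP => j; rewrite mxE -(inord_val j).
have [re0 im0] := b0 j (ltn_ord j).
by apply/eqP; rewrite eq_complex /= re0 im0 eqxx.
Qed.

Definition col4 (s : seq R[i]) : 'cV[R[i]]_4 := \col_j s`_j.

Lemma degree_mxminpoly_gt3 (A : 'M[R]_4) :
  (forall c0 c1 c2, c0 *: 1%:M + c1 *: A + c2 *: A ^+ 2 + A ^+ 3 != 0) ->
  (3 < degree_mxminpoly A)%N.
Proof.
move=> no_cubic; apply: degree_mxminpoly_gt => p p_monic size_p.
have -> : horner_mx A p = p`_0 *: 1%:M + p`_1 *: A + p`_2 *: A ^+ 2 + A ^+ 3.
  have p3 : p`_3 = 1 by have := monicP p_monic; rewrite lead_coefE size_p.
  have {1}-> : p = \poly_(j < 4) p`_j by rewrite -size_p coefK.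
  rewrite poly_def !big_ord_recr big_ord0 /= add0r p3 !rmorphD /= !linearZ /=.
  by rewrite !rmorphXn /= !horner_mx_X expr0 expr1 !scale1r.
exact: no_cubic.
Qed.

Lemma unitmx4 (A : 'M[R]_4) :
  (forall v : 'rV[R]_4, v *m A = 0 -> v = 0) -> A \in unitmx.
Proof.
move=> inj; rewrite -row_free_unit -kermx_eq0; apply/eqP/row_matrixP => j.
by rewrite row0; apply: inj; rewrite -row_mul mulmx_ker row0.
Qed.

End OrderFour.

Ltac expand4 := rewrite ?sum4E; unfold sum4; rewrite ?inordK //=.

(** * A gap between real and complex vectors *)

Section VectorGap.
Variable R : realType.

Definition vector_gap_mx : 'M[R]_4 := mx4
  [:: [:: 7; 0; 11; 0]; [:: 0; - 7; 0; 11];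
      [:: - 11; 0; 0; 21]; [:: 0; - 11; 21; 0]].

Lemma vector_gap_sqr : vector_gap_mx ^+ 2 = mx4
  [:: [:: - 72; 0; 77; 231]; [:: 0; - 72; 231; - 77];
      [:: - 77; - 231; 320; 0]; [:: - 231; 77; 0; 320]].
Proof.
rewrite expr2 [LHS]mx4M; congr mx4; rewrite /sum4 /=.
by do ![congr (_ :: _)]; ring.
Qed.

Lemma vector_gap_cube : vector_gap_mx ^+ 3 = mx4
  [:: [:: - (7 * 193); - (21 * 121); 11 * 369; 7 * 231];
      [:: - (21 * 121); 7 * 193; - (7 * 231); 11 * 369];
      [:: - (11 * 369); 7 * 231; - (7 * 121); 21 * 199];
      [:: - (7 * 231); - (11 * 369); 21 * 199; 7 * 121]].
Proof.
rewrite exprS vector_gap_sqr [LHS]mx4M; congr mx4; rewrite /sum4 /=.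
by do ![congr (_ :: _)]; ring.
Qed.

(** With [P = w1 w2] and [Q = w1^2 - w2^2], the equations determine
    [u1^2 - u2^2], [u1 u2] and [|u|^2] from [P], [Q] and [|w|^2].  The relations
    [|u|^4 = (u1^2 - u2^2)^2 + 4 (u1 u2)^2] and [|w|^4 = Q^2 + 4 P^2] (rank
    one) then make a positive definite form in [P] and [Q] vanish. *)
Lemma vector_gap_no_real_solution (u1 u2 w1 w2 : R) :
  7 * (u1 ^+ 2 - u2 ^+ 2) + 42 * (w1 * w2) = 0 ->
  320 * (w1 ^+ 2 + w2 ^+ 2) = 72 * (u1 ^+ 2 + u2 ^+ 2) ->
  - (7 * 193) * (u1 ^+ 2 - u2 ^+ 2) - 2 * (21 * 121) * (u1 * u2)
  - (7 * 121) * (w1 ^+ 2 - w2 ^+ 2) + 2 * (21 * 199) * (w1 * w2) = 0 ->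
  [/\ u1 = 0, u2 = 0, w1 = 0 & w2 = 0].
Proof.
move=> E1 E2 E3.
pose P := w1 * w2; pose Q := w1 ^+ 2 - w2 ^+ 2.
have D : u1 ^+ 2 - u2 ^+ 2 = - 6 * P by rewrite /P; lra.
have S : 9 * (u1 ^+ 2 + u2 ^+ 2) = 40 * (w1 ^+ 2 + w2 ^+ 2) by lra.
have X : 121 * (6 * (u1 * u2) + Q) = 7 * 336 * P by rewrite /P /Q; lra.
have WPQ : (w1 ^+ 2 + w2 ^+ 2) ^+ 2 = 4 * P ^+ 2 + Q ^+ 2.
  by rewrite /P /Q; ring.
have UDX : (u1 ^+ 2 + u2 ^+ 2) ^+ 2 =
    (u1 ^+ 2 - u2 ^+ 2) ^+ 2 + 4 * (u1 * u2) ^+ 2.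
  by ring.
have VE : u1 * u2 = ((7 * 336) / 121 * P - Q) / 6 by lra.
have UE : u1 ^+ 2 + u2 ^+ 2 = 40 / 9 * (w1 ^+ 2 + w2 ^+ 2) by lra.
move: UDX; rewrite D VE UE exprMn WPQ => key.
have P0 : P ^+ 2 + Q ^+ 2 <= 0.
  have := sqr_ge0 (10 * P + 21 * Q); have := sqr_ge0 (P + 2 * Q).
  have := sqr_ge0 Q; have := sqr_ge0 P; lra.
have W0 : (w1 ^+ 2 + w2 ^+ 2) ^+ 2 <= 0.
  by rewrite WPQ; have := sqr_ge0 Q; have := sqr_ge0 P; lra.
have {}W0 : w1 ^+ 2 + w2 ^+ 2 = 0.
  by apply/eqP; rewrite -sqrf_eq0 eq_le W0 sqr_ge0.
have sqr0 (x y : R) : x ^+ 2 + y ^+ 2 = 0 -> x = 0 /\ y = 0.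
  move=> /eqP; rewrite paddr_eq0 ?sqr_ge0 // !sqrf_eq0.
  by case/andP=> /eqP -> /eqP ->.
have [-> ->] := sqr0 _ _ W0.
by have [|-> ->] := sqr0 u1 u2; [rewrite UE W0 mulr0 | split].
Qed.

Lemma vector_gap_real_stagnates (b : 'cV[R[i]]_4) : b \is a mxOver (realF R) ->
  stagnates 3 (cplxF R) vector_gap_mx b -> b = 0.
Proof.
move=> /mxOverP Fb /stagnates_complex forms0.
have im0 j : Im (b j 0) = 0 by apply/eqP; rewrite -scalar_in_realF.
have [+ _] := forms0 0%N isT; have [+ _] := forms0 1%N isT.
have [+ _] := forms0 2%N isT; rewrite expr1.
rewrite vector_gap_sqr vector_gap_cube !form_re_mx4.
expand4; rewrite !im0; move=> E3 E2 E1.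
have [||| x0 x1 x2 x3] := @vector_gap_no_real_solution (Re (b (inord 0) 0))
  (Re (b (inord 1) 0)) (Re (b (inord 2) 0)) (Re (b (inord 3) 0)).
- lra.
- lra.
- lra.
by apply: col4_eq0 => -[|[|[|[|//]]]] _; rewrite im0.
Qed.

(** The halves are multiples of the isotropic vectors [(1, - i)] and [(1, i)].
    The factor [2 + 6 i] is proportional to [7 + 21 i], which gives the
    relative phase for which the two off-diagonal contributions are real; its
    modulus gives the ratio 40 : 9 of the squared norms. *)
Definition vector_gap_solution : 'cV[R[i]]_4 :=
  col4 [:: 2 +i* 6; 6 -i* 2; 3%:C; 3 *i]%C.

Lemma vector_gap_solution_stagnates :
  stagnates 3 (cplxF R) vector_gap_mx vector_gap_solution.
Proof.
apply/stagnates_complex => -[|[|[|//]]] _;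
  rewrite ?expr1 ?vector_gap_sqr ?vector_gap_cube form_re_mx4 form_im_mx4;
  expand4; rewrite !mxE; expand4; split; lra.
Qed.

Lemma vector_gap_unit : vector_gap_mx \in unitmx.
Proof.
apply: unitmx4 => v /rowP vA0.
have E0 := vA0 (inord 0); have E1 := vA0 (inord 1).
have E2 := vA0 (inord 2); have E3 := vA0 (inord 3).
move: E0 E1 E2 E3; rewrite !mxE; expand4; rewrite !mx4E //= => E0 E1 E2 E3.
apply/rowP => j; rewrite mxE -(inord_val j).
by case: j => -[|[|[|[|//]]]] /= _; lra.
Qed.

Lemma vector_gap_degree : (3 < degree_mxminpoly vector_gap_mx)%N.
Proof.
apply: degree_mxminpoly_gt3 => c0 c1 c2; apply/eqP => /matrixP cubic.
have := cubic (inord 0) (inord 1); rewrite vector_gap_sqr vector_gap_cube !mxE.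
expand4; rewrite -val_eqE /= !inordK //= => E; lra.
Qed.

End VectorGap.

(** * A gap between real and complex coefficients *)

Section CoefficientGap.
Variable R : realType.

(** The value of [e] used below, 1/3600, is small enough for crude estimates.
    It is written [1 / 60 / 60] because numerals are unary, hence costly when
    large. *)
Definition coef_gap_mx (e : R) : 'M[R]_4 := mx4
  [:: [:: 0; 6 * e; 1; 0]; [:: - (6 * e); 0; 0; 4];
      [:: 20 * e; 6 * e; 0; 6 * e]; [:: 6 * e; 5 * e; - (6 * e); 0]].

Lemma coef_gap_sqr e : coef_gap_mx e ^+ 2 = mx4
  [:: [:: 20 * e - 36 * e ^+ 2; 6 * e; 0; 30 * e];
      [:: 24 * e; 20 * e - 36 * e ^+ 2; - (30 * e); 0];
      [:: 0; 150 * e ^+ 2; 20 * e - 36 * e ^+ 2; 24 * e];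
      [:: - (150 * e ^+ 2); 0; 6 * e; 20 * e - 36 * e ^+ 2]].
Proof.
rewrite expr2 [LHS]mx4M; congr mx4; rewrite /sum4 /=.
by do ![congr (_ :: _)]; ring.
Qed.

Lemma coef_gap_cube e : coef_gap_mx e ^+ 3 = mx4
  [:: [:: 144 * e ^+ 2; 270 * e ^+ 2 - 216 * e ^+ 3;
          20 * e - 216 * e ^+ 2; 24 * e];
      [:: - (720 * e ^+ 2) + 216 * e ^+ 3; - (36 * e ^+ 2);
          24 * e; 80 * e - 324 * e ^+ 2];
      [:: 544 * e ^+ 2 - 5 * 324 * e ^+ 3; 240 * e ^+ 2 - 216 * e ^+ 3;
          - (144 * e ^+ 2); 720 * e ^+ 2 - 216 * e ^+ 3];
      [:: 240 * e ^+ 2 - 216 * e ^+ 3; 136 * e ^+ 2 - 5 * 216 * e ^+ 3;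
          - (270 * e ^+ 2) + 216 * e ^+ 3; 36 * e ^+ 2]].
Proof.
rewrite exprS coef_gap_sqr [LHS]mx4M; congr mx4; rewrite /sum4 /=.
by do ![congr (_ :: _)]; ring.
Qed.

(** [Dij] stands for the real part of [zi* zj]; the two equations are the
    real parts of those for [A] and, divided by [e], for [A^3].  Their leading
    terms are [D13 + 4 D24] and [20 (D13 + 4 D24) + 24 (D14 + D23)], so both
    [D13 + 4 D24] and [D14 + D23] are of order [e |z|^2]; the conclusions are
    about the real parts of [a* c] and [b* d]. *)
Lemma coef_gap_dots (e D11 D22 D33 D44 D12 D13 D14 D23 D24 D34 : R) :
  e = 1 / 60 / 60 ->
  0 <= D11 -> 0 <= D22 -> 0 <= D33 -> 0 <= D44 ->
  `|2 * D12| <= D11 + D22 -> `|2 * D13| <= D11 + D33 ->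
  `|2 * D14| <= D11 + D44 -> `|2 * D23| <= D22 + D33 ->
  `|2 * D24| <= D22 + D44 -> `|2 * D34| <= D33 + D44 ->
  (1 + 20 * e) * D13 + (4 + 5 * e) * D24 + 6 * e * (D23 + D14) = 0 ->
  (20 + 328 * e - 5 * 324 * e ^+ 2) * D13
   + (80 - 188 * e - 5 * 216 * e ^+ 2) * D24
   + (24 + 240 * e - 216 * e ^+ 2) * (D14 + D23)
   + e * (144 * D11 - 36 * D22 - 144 * D33 + 36 * D44
          - 450 * D12 + 450 * D34) = 0 ->
  `|D13 + 2 * D14 + 2 * D23 + 4 * D24| <= (D11 + D22 + D33 + D44) / 45 /\
  `|D13 - 2 * D14 - 2 * D23 + 4 * D24| <= (D11 + D22 + D33 + D44) / 45.
Proof.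
move=> ->; rewrite !ler_norml => ? ? ? ?.
do 6![case/andP=> ? ?]; move=> E1 E3; split; apply/andP; split; lra.
Qed.

(** The same estimate for the imaginary parts; [Kij] is antisymmetric, which
    changes the lower order terms. *)
Lemma coef_gap_crosses (e D11 D22 D33 D44 K12 K13 K14 K23 K24 K34 : R) :
  e = 1 / 60 / 60 ->
  0 <= D11 -> 0 <= D22 -> 0 <= D33 -> 0 <= D44 ->
  `|2 * K12| <= D11 + D22 -> `|2 * K13| <= D11 + D33 ->
  `|2 * K14| <= D11 + D44 -> `|2 * K23| <= D22 + D33 ->
  `|2 * K24| <= D22 + D44 -> `|2 * K34| <= D33 + D44 ->
  (1 - 20 * e) * K13 + (4 - 5 * e) * K24 - 6 * e * (K23 + K14)
   + 12 * e * (K12 + K34) = 0 ->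
  (20 - 760 * e + 5 * 324 * e ^+ 2) * K13
   + (80 - 460 * e + 5 * 216 * e ^+ 2) * K24
   + (24 - 240 * e + 216 * e ^+ 2) * (K14 + K23)
   + (990 * e - 432 * e ^+ 2) * (K12 + K34) = 0 ->
  `|K13 + 2 * K14 + 2 * K23 + 4 * K24| <= (D11 + D22 + D33 + D44) / 45 /\
  `|K13 - 2 * K14 - 2 * K23 + 4 * K24| <= (D11 + D22 + D33 + D44) / 45.
Proof.
move=> ->; rewrite !ler_norml => ? ? ? ?.
do 6![case/andP=> ? ?]; move=> E1 E3; split; apply/andP; split; lra.
Qed.

Implicit Types x y t : R.

Definition modulus (x y : R) : R := Num.sqrt (x ^+ 2 + y ^+ 2).

Lemma modulus_sqr x y : modulus x y ^+ 2 = x ^+ 2 + y ^+ 2.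
Proof. by rewrite sqr_sqrtr // addr_ge0 ?sqr_ge0. Qed.

Lemma modulusM x y x' y' : modulus x y * modulus x' y' =
  Num.sqrt ((x * x' + y * y') ^+ 2 + (y * x' - x * y') ^+ 2).
Proof. by rewrite -sqrtrM ?addr_ge0 ?sqr_ge0 //; congr Num.sqrt; ring. Qed.

Lemma dot_modulus x y x' y' : `|x * x' + y * y'| <= modulus x y * modulus x' y'.
Proof. by rewrite modulusM -sqrtr_sqr ler_wsqrtr // lerDl sqr_ge0. Qed.

(** The bound holds because 45 > 30 sqrt 2. *)
Lemma modulusM_le x y x' y' t d k : 0 <= t ->
  d = x * x' + y * y' -> k = y * x' - x * y' ->
  `|d| <= t / 45 -> `|k| <= t / 45 ->
  modulus x y * modulus x' y' <= t / 30.
Proof.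
move=> t_ge0 -> -> dot_le cross_le; have t30 : 0 <= t / 30 by lra.
have t45 : 0 <= t / 45 by lra.
rewrite modulusM -[t / 30]ger0_norm // -sqrtr_sqr ler_wsqrtr //.
have sqr_le z : `|z| <= t / 45 -> z ^+ 2 <= (t / 45) ^+ 2.
  by move=> z_le; rewrite -[z ^+ 2]real_normK ?num_real // lerXn2r ?nnegrE.
have := sqr_le _ dot_le; have := sqr_le _ cross_le; have := sqr_ge0 t; lra.
Qed.

(** The form on the right, without its last two terms, has the edges [AB], [BC],
    [CD], [DA] and is at least
    [10 (A + C)^2 + 5/2 (B + D)^2 - 15/2 (A + C) (B + D) - 20 A C - 5 B D]. *)
Lemma four_cycle (A B C D ab cd bc ad : R) :
  0 <= A * C -> 0 <= B * D ->
  `|ab| <= A * B -> `|cd| <= C * D -> `|bc| <= B * C -> `|ad| <= A * D ->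
  5 / 8 * (A ^+ 2 + B ^+ 2 + C ^+ 2 + D ^+ 2) <=
  10 * A ^+ 2 + 5 / 2 * B ^+ 2 + 10 * C ^+ 2 + 5 / 2 * D ^+ 2
  + 15 / 2 * (ab + cd + bc - ad) + 20 * (A * C) + 5 * (B * D).
Proof.
rewrite !ler_norml => ? ? /andP[? _] /andP[? _] /andP[? _] /andP[_ ?].
have := sqr_ge0 (2 * (A + C) - (B + D)).
by have := sqr_ge0 A; have := sqr_ge0 C; lra.
Qed.

Lemma dot_young x y x' y' :
  `|2 * (x * x' + y * y')| <= (x * x + y * y) + (x' * x' + y' * y').
Proof.
rewrite ler_norml; have := sqr_ge0 (x - x'); have := sqr_ge0 (y - y').
by have := sqr_ge0 (x + x'); have := sqr_ge0 (y + y'); lra.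
Qed.

Lemma cross_young x y x' y' :
  `|2 * (y * x' - x * y')| <= (x * x + y * y) + (x' * x' + y' * y').
Proof.
rewrite ler_norml; have := sqr_ge0 (y - x'); have := sqr_ge0 (x - y').
by have := sqr_ge0 (y + x'); have := sqr_ge0 (x + y'); lra.
Qed.

(** The last equation is the one for [A^2], divided by [e].  Its leading part is
    the form of [four_cycle] in the coordinates [a, b, c, d]. *)
Lemma four_cycle_definite (e x1 y1 x2 y2 x3 y3 x4 y4 : R) :
  let N := x1 * x1 + y1 * y1 + (x2 * x2 + y2 * y2) + (x3 * x3 + y3 * y3)
    + (x4 * x4 + y4 * y4) in
  e = 1 / 60 / 60 ->
  modulus (x1 + 2 * x2) (y1 + 2 * y2) * modulus (x3 + 2 * x4) (y3 + 2 * y4)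
    <= N / 30 ->
  modulus (x1 - 2 * x2) (y1 - 2 * y2) * modulus (x3 - 2 * x4) (y3 - 2 * y4)
    <= N / 30 ->
  (20 - 36 * e) * N + 30 * (x1 * x2 + y1 * y2 + (x3 * x4 + y3 * y4))
    + (30 - 150 * e) * (x1 * x4 + y1 * y4 - (x2 * x3 + y2 * y3)) = 0 ->
  N <= 0.
Proof.
move=> N -> AC BD E2.
have modulus_ge0 x y : 0 <= modulus x y := sqrtr_ge0 _.
have := four_cycle (mulr_ge0 (modulus_ge0 _ _) (modulus_ge0 _ _))
  (mulr_ge0 (modulus_ge0 _ _) (modulus_ge0 _ _))
  (dot_modulus (x1 + 2 * x2) (y1 + 2 * y2) (x1 - 2 * x2) (y1 - 2 * y2))
  (dot_modulus (x3 + 2 * x4) (y3 + 2 * y4) (x3 - 2 * x4) (y3 - 2 * y4))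
  (dot_modulus (x1 - 2 * x2) (y1 - 2 * y2) (x3 + 2 * x4) (y3 + 2 * y4))
  (dot_modulus (x1 + 2 * x2) (y1 + 2 * y2) (x3 - 2 * x4) (y3 - 2 * y4)).
rewrite !modulus_sqr.
move: AC BD; set ac := modulus _ _ * _; set bd := modulus _ _ * _.
move=> AC BD cycle.
(* The remaining products only occur with the small factor [e]. *)
move: (dot_young x1 y1 x4 y4) (dot_young x2 y2 x3 y3).
rewrite !ler_norml => /andP[? ?] /andP[? ?].
have := sqr_ge0 x2; have := sqr_ge0 y2; have := sqr_ge0 x4; have := sqr_ge0 y4.
by move: cycle AC BD E2; rewrite /N; lra.
Qed.

Lemma coef_gap_stagnates (e : R) (b : 'cV[R[i]]_4) : e = 1 / 60 / 60 ->
  stagnates 3 (cplxF R) (coef_gap_mx e) b -> b = 0.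
Proof.
move=> eE /stagnates_complex forms0.
have e_neq0 : e != 0 by rewrite eE; lra.
move: (forms0 0%N isT) (forms0 1%N isT) (forms0 2%N isT).
rewrite expr1 coef_gap_sqr coef_gap_cube !form_re_mx4 !form_im_mx4; expand4.
set x1 := Re (b (inord 0) 0); set y1 := Im (b (inord 0) 0).
set x2 := Re (b (inord 1) 0); set y2 := Im (b (inord 1) 0).
set x3 := Re (b (inord 2) 0); set y3 := Im (b (inord 2) 0).
set x4 := Re (b (inord 3) 0); set y4 := Im (b (inord 3) 0).
move=> [E1 F1] [E2 _] [E3 F3].
have sq_ge0 (x y : R) : 0 <= x * x + y * y by rewrite -!expr2 addr_ge0 ?sqr_ge0.
have [||ac bd] := coef_gap_dots eE (sq_ge0 x1 y1) (sq_ge0 x2 y2) (sq_ge0 x3 y3)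
  (sq_ge0 x4 y4) (dot_young _ _ _ _) (dot_young _ _ _ _) (dot_young _ _ _ _)
  (dot_young _ _ _ _) (dot_young _ _ _ _) (dot_young _ _ _ _).
- by rewrite -[RHS]E1; ring.
- by apply: (mulfI e_neq0); rewrite mulr0 -[RHS]E3; ring.
have [||ac' bd'] := coef_gap_crosses eE (sq_ge0 x1 y1) (sq_ge0 x2 y2)
  (sq_ge0 x3 y3) (sq_ge0 x4 y4) (cross_young _ _ _ _) (cross_young _ _ _ _)
  (cross_young _ _ _ _) (cross_young _ _ _ _) (cross_young _ _ _ _)
  (cross_young _ _ _ _).
- by rewrite -[RHS]F1; ring.
- by apply: (mulfI e_neq0); rewrite mulr0 -[RHS]F3; ring.
pose N := x1 * x1 + y1 * y1 + (x2 * x2 + y2 * y2) + (x3 * x3 + y3 * y3)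
  + (x4 * x4 + y4 * y4).
have N_ge0 : 0 <= N by rewrite /N -!expr2 !addr_ge0 ?sqr_ge0.
have AC : modulus (x1 + 2 * x2) (y1 + 2 * y2) *
    modulus (x3 + 2 * x4) (y3 + 2 * y4) <= N / 30.
  by apply: (modulusM_le N_ge0 _ _ ac ac'); ring.
have BD : modulus (x1 - 2 * x2) (y1 - 2 * y2) *
    modulus (x3 - 2 * x4) (y3 - 2 * y4) <= N / 30.
  by apply: (modulusM_le N_ge0 _ _ bd bd'); ring.
have N_le0 : N <= 0.
  apply: (four_cycle_definite eE AC BD).
  by apply: (mulfI e_neq0); rewrite mulr0 -[RHS]E2 /N; ring.
have : N == 0 by rewrite eq_le N_le0 N_ge0.
rewrite /N !paddr_eq0 ?addr_ge0 // -?expr2 ?sqr_ge0 // !sqrf_eq0.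
move=> /andP[/andP[/andP[/andP[/eqP ? /eqP ?] /andP[/eqP ? /eqP ?]]
  /andP[/eqP ? /eqP ?]] /andP[/eqP ? /eqP ?]].
by apply: col4_eq0 => -[|[|[|[|//]]]] _; split.
Qed.

(** This is [x + i Q x] for [x = (1, - s, 0, - s)] and [Q (u, w) = (- w, u)]. *)
Definition coef_gap_solution (s : R) : 'cV[R[i]]_4 :=
  col4 [:: 1; (- s) +i* s; 'i; (- s) -i* s]%C.

Lemma coef_gap_solution_stagnates (e s : R) :
  (20 - 36 * e) * (1 + 2 * s ^+ 2) = (60 - 150 * e) * s ->
  stagnates 3 (realF R) (coef_gap_mx e) (coef_gap_solution s).
Proof.
move=> sE; apply/stagnates_real.
(* The hypothesis on [s] is the equation for the square; those for the first and
   third powers hold for all [s]. *)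
move=> -[|[|[|//]]] _; rewrite ?expr1 ?coef_gap_sqr ?coef_gap_cube;
  rewrite form_re_mx4; expand4; rewrite !mxE; expand4.
- ring.
- have := congr1 (fun t => 2 * e * t) sE; lra.
- ring.
Qed.

Lemma coef_gap_root (e : R) : e = 1 / 60 / 60 ->
  exists s, (20 - 36 * e) * (1 + 2 * s ^+ 2) = (60 - 150 * e) * s.
Proof.
move=> eE; pose g := 20 - 36 * e; pose h := 60 - 150 * e.
have disc_ge0 : 0 <= h ^+ 2 - 8 * g ^+ 2 by rewrite /g /h eE; lra.
have g_neq0 : g != 0 by rewrite /g eE; lra.
exists ((h + Num.sqrt (h ^+ 2 - 8 * g ^+ 2)) / (4 * g)).
rewrite -/g -/h; have := sqr_sqrtr disc_ge0; set r := Num.sqrt _ => rE.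
have : (h + r) ^+ 2 + 8 * g ^+ 2 - 2 * h * (h + r) = 0 by lra.
move=> root; apply/eqP; rewrite -subr_eq0; apply/eqP.
have -> : g * (1 + 2 * ((h + r) / (4 * g)) ^+ 2) - h * ((h + r) / (4 * g)) =
  ((h + r) ^+ 2 + 8 * g ^+ 2 - 2 * h * (h + r)) / (8 * g) by field.
by rewrite root mul0r.
Qed.

Lemma coef_gap_unit (e : R) : e = 1 / 60 / 60 -> coef_gap_mx e \in unitmx.
Proof.
move=> eE; apply: unitmx4 => v /rowP vA0.
have E0 := vA0 (inord 0); have E1 := vA0 (inord 1).
have E2 := vA0 (inord 2); have E3 := vA0 (inord 3).
move: E0 E1 E2 E3; rewrite !mxE; expand4; rewrite !mx4E //= eE => E0 E1 E2 E3.
apply/rowP => j; rewrite mxE -(inord_val j).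
by case: j => -[|[|[|[|//]]]] /= _; lra.
Qed.

Lemma coef_gap_degree (e : R) : e = 1 / 60 / 60 ->
  (3 < degree_mxminpoly (coef_gap_mx e))%N.
Proof.
move=> eE; apply: degree_mxminpoly_gt3 => c0 c1 c2; apply/eqP => /matrixP cubic.
have := cubic (inord 0) (inord 0); have := cubic (inord 1) (inord 1).
have := cubic (inord 0) (inord 3); rewrite coef_gap_sqr coef_gap_cube !mxE.
by expand4; rewrite -!val_eqE /= !inordK //= eE => E03 E11 E00; lra.
Qed.

End CoefficientGap.

(** * The theorem *)

Theorem theorem6p3 (R : realType) :
  [/\ forall (n : nat) (A : 'M[R]_n.+1) (k : nat),
        A \in unitmx -> (1 <= k <= degree_mxminpoly A - 1)%N ->
        [/\ Psi k (realF R) (realF R) A = Psi k (cplxF R) (realF R) A,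
            Psi k (cplxF R) (realF R) A <= Psi k (cplxF R) (cplxF R) A
          & Psi k (cplxF R) (cplxF R) A <= Psi k (realF R) (cplxF R) A],
      exists (n : nat) (A : 'M[R]_n.+1) (k : nat),
        [/\ A \in unitmx, (1 <= k <= degree_mxminpoly A - 1)%N
          & Psi k (cplxF R) (realF R) A < Psi k (cplxF R) (cplxF R) A]
    & exists (n : nat) (A : 'M[R]_n.+1) (k : nat),
        [/\ A \in unitmx, (1 <= k <= degree_mxminpoly A - 1)%N
          & Psi k (cplxF R) (cplxF R) A < Psi k (realF R) (cplxF R) A]].
Proof.
have k3 (A : 'M[R]_4) : (3 < degree_mxminpoly A)%N ->
    (1 <= 3 <= degree_mxminpoly A - 1)%N.
  by rewrite subn1; case: degree_mxminpoly.
split.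
- move=> n A k _ _; split; first exact: Psi_real_vectors.
    by apply: Psi_vectors_mono; [right | left | right | move=> x].
  by apply: Psi_coefficients_anti; [right | left | right | move=> x].
- exists 3%N, (vector_gap_mx R), 3%N; split.
  + exact: vector_gap_unit.
  + exact/k3/vector_gap_degree.
  apply: (@lt_le_trans _ _ 1).
    by apply: Psi_lt1 (@vector_gap_real_stagnates R); [right | left].
  apply: (@Psi_ge1 _ _ _ _ _ _ (vector_gap_solution R)).
  + by right.
  + by right.
  + exact/mxOverP.
  + apply/eqP => /colP/(_ (inord 3)); rewrite !mxE inordK //= => /eqP.
    by rewrite eq_complex /= => /andP[_ /eqP]; lra.
  + exact: vector_gap_solution_stagnates.
- have eE : 1 / 60 / 60 = 1 / 60 / 60 :> R by [].
  exists 3%N, (coef_gap_mx (1 / 60 / 60)), 3%N; split.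
  + exact: coef_gap_unit.
  + exact/k3/coef_gap_degree.
  apply: (@lt_le_trans _ _ 1).
    apply: Psi_lt1; [by right | by right |].
    by move=> b _; apply: coef_gap_stagnates.
  have [s sE] := coef_gap_root eE.
  apply: (@Psi_ge1 _ _ _ _ _ _ (coef_gap_solution s)).
  + by left.
  + by right.
  + exact/mxOverP.
  + apply/eqP => /colP/(_ (inord 2)); rewrite !mxE inordK //= => /eqP.
    by rewrite eq_complex /= => /andP[_ /eqP]; lra.
  + exact: coef_gap_solution_stagnates.
Qed.
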